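(* Let $\beta\in\{1/2,1,2\}$, $n\ge1$, and for real diagonal matrices $X=\mathrm{diag}(x_1,\dots,x_n)$ with distinct $x_i$ and $Y=\mathrm{diag}(y_1,\dots,y_n)$ with distinct $y_j$ let $$M_{i,j}=M_{i,j}(X,Y)=\int_{G_{\beta,n}}dO\;\|O_{i,j}\|^2\,e^{\mathrm{Tr}\,XOYO^{-1}} .$$ Then for all $i,j\in\{1,\dots,n\}$: $$\frac{\partial M_{i,j}}{\partial y_j}+\beta\sum_{l\ne j}\frac{M_{i,l}-M_{i,j}}{y_l-y_j}=x_i\,M_{i,j},$$ and symmetrically $$\frac{\partial M_{i,j}}{\partial x_i}+\beta\sum_{k\ne i}\frac{M_{i,j}-M_{k,j}}{x_i-x_k}=y_j\,M_{i,j}.$$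
   Context: $G_{1/2,n}=O(n)$, $G_{1,n}=U(n)$, $G_{2,n}=Sp(2n)$ (compact group of $n\times n$ quaternionic unitary matrices), $dO$ is the Haar measure, $\|\cdot\|$ is the real, complex or quaternionic modulus, and $\mathrm{Tr}$ is normalized (once per quaternionic dimension when $\beta=2$) so that $\mathrm{Tr}\,XOYO^{-1}=\sum_{i,j}x_iy_j\|O_{i,j}\|^2$. *)

(* Defs.v *)
From HB Require Import structures.
From mathcomp Require Import all_boot all_order all_algebra.
From mathcomp Require Import complex ring.
From mathcomp Require Import all_classical all_reals all_analysis.

Set Implicit Arguments.
Unset Strict Implicit.
Unset Printing Implicit Defensive.

Import Order.TTheory GRing.Theory Num.Theory.
Import numFieldNormedType.Exports.

Local Open Scope classical_set_scope.
Local Open Scope ring_scope.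

(* Hamilton's quaternions; [Quat a b c d] is a + b i + c j + d k. *)
Record quat (R : Type) := Quat { qre : R; qi : R; qj : R; qk : R }.

Section QuatChoice.
Variable R : choiceType.

Definition quat_to_prod (q : quat R) := (qre q, qi q, qj q, qk q).
Definition quat_of_prod (p : R * R * R * R) :=
  Quat p.1.1.1 p.1.1.2 p.1.2 p.2.

Lemma quat_to_prodK : cancel quat_to_prod quat_of_prod.
Proof. by case. Qed.

HB.instance Definition _ := Choice.copy (quat R) (can_type quat_to_prodK).
End QuatChoice.

Section QuatRing.
Variable R : comNzRingType.
Implicit Types p q : quat R.

Definition addq p q :=
  Quat (qre p + qre q) (qi p + qi q) (qj p + qj q) (qk p + qk q).
Definition oppq q := Quat (- qre q) (- qi q) (- qj q) (- qk q).
Definition zeroq : quat R := Quat 0 0 0 0.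
Definition oneq : quat R := Quat 1 0 0 0.
Definition mulq p q :=
  Quat (qre p * qre q - qi p * qi q - qj p * qj q - qk p * qk q)
       (qre p * qi q + qi p * qre q + qj p * qk q - qk p * qj q)
       (qre p * qj q - qi p * qk q + qj p * qre q + qk p * qi q)
       (qre p * qk q + qi p * qj q - qj p * qi q + qk p * qre q).
Definition conjq q := Quat (qre q) (- qi q) (- qj q) (- qk q).

Lemma addqA : associative addq.
Proof. by move=> [????] [????] [????]; rewrite /addq /= !addrA. Qed.
Lemma addqC : commutative addq.
Proof. by move=> [????] [????]; congr Quat; exact: addrC. Qed.
Lemma add0q : left_id zeroq addq.
Proof. by move=> [????]; rewrite /addq /= !add0r. Qed.
Lemma addNq : left_inverse zeroq oppq addq.
Proof. by move=> [????]; rewrite /addq /= !addNr. Qed.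

HB.instance Definition _ :=
  GRing.isZmodule.Build (quat R) addqA addqC add0q addNq.

Lemma mulqA : associative mulq.
Proof. by move=> [????] [????] [????]; congr Quat => /=; ring. Qed.
Lemma mul1q : left_id oneq mulq.
Proof. by move=> [????]; congr Quat => /=; ring. Qed.
Lemma mulq1 : right_id oneq mulq.
Proof. by move=> [????]; congr Quat => /=; ring. Qed.
Lemma mulqDl : left_distributive mulq addq.
Proof. by move=> [????] [????] [????]; congr Quat => /=; ring. Qed.
Lemma mulqDr : right_distributive mulq addq.
Proof. by move=> [????] [????] [????]; congr Quat => /=; ring. Qed.
Lemma oneq_neq0 : oneq != zeroq.
Proof. by apply/eqP => -[] /eqP; rewrite oner_eq0. Qed.

HB.instance Definition _ := GRing.Zmodule_isNzRing.Build (quat R)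
  mulqA mul1q mulq1 mulqDl mulqDr oneq_neq0.
End QuatRing.

Variant dyson := BetaHalf | BetaOne | BetaTwo.

Section Scalars.
Variable R : realType.

Definition beta (b : dyson) : R :=
  match b with BetaHalf => 2^-1 | BetaOne => 1 | BetaTwo => 2 end.

Definition scalar (b : dyson) : nzRingType :=
  match b with BetaHalf => R | BetaOne => R[i] | BetaTwo => quat R end.

Definition of_real (b : dyson) : R -> scalar b :=
  match b return R -> scalar b with
  | BetaHalf => fun a => a
  | BetaOne => fun a => Complex a 0
  | BetaTwo => fun a => Quat a 0 0 0
  end.

Definition conjs (b : dyson) : scalar b -> scalar b :=
  match b return scalar b -> scalar b with
  | BetaHalf => fun z => z
  | BetaOne => fun z => conjc z
  | BetaTwo => fun z => conjq z
  end.

(* The real coordinates of a scalar, real part first. *)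
Definition coords (b : dyson) : scalar b -> seq R :=
  match b return scalar b -> seq R with
  | BetaHalf => fun z => [:: z]
  | BetaOne => fun z => [:: complex.Re z; complex.Im z]
  | BetaTwo => fun z => [:: qre z; qi z; qj z; qk z]
  end.

End Scalars.

Section Groups.
Variables (R : realType) (b : dyson).
Local Notation scalar := (scalar R b).

Definition realpart (z : scalar) : R := (coords z)`_0.

Definition modulus (z : scalar) : R := Num.sqrt (\sum_(a <- coords z) a ^+ 2).

Variable n : nat.

(* An alias, since the library has no pointed type structure on matrices over
   a general ring. *)
Definition smx : Type := 'M[scalar]_n.
HB.instance Definition _ := Choice.on smx.
HB.instance Definition _ := isPointed.Build smx (0 : 'M[scalar]_n).

Definition adjmx (A : 'M[scalar]_n) : 'M[scalar]_n := (map_mx (@conjs R b) A)^T.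

(* O(n), U(n), Sp(2n) for beta = 1/2, 1, 2 *)
Definition Ggroup : set smx :=
  [set O : 'M[scalar]_n | O *m adjmx O = 1%:M /\ adjmx O *m O = 1%:M].

(* The sigma-algebra generated by [coord_cylinders] is the Borel sigma-algebra
   of 'M[scalar]_n seen as a finite-dimensional real space: it is the product
   of the Borel sigma-algebras of the real coordinates of the entries. *)
Definition coord_cylinders : set (set smx) :=
  [set A | exists (i j : 'I_n) (k : nat) (B : set (measurableTypeR R)),
    measurable B /\ A = [set O : 'M[scalar]_n | B (coords (O i j))`_k]].

Definition bmx : measurableType coord_cylinders.-sigma :=
  g_sigma_algebraType coord_cylinders.

(* The restriction of [mu] to the compact group [Ggroup] is a Haar measure on
   it, in an arbitrary normalization; [mu] is irrelevant outside [Ggroup]. *)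
Definition is_haar (mu : {measure set bmx -> \bar R}) : Prop :=
  [/\ (0 < mu Ggroup)%E, (mu Ggroup < +oo)%E &
      forall (O : 'M[scalar]_n) (A : set bmx),
        Ggroup O -> measurable A -> A `<=` Ggroup ->
        mu ((fun P : 'M[scalar]_n => O *m P) @` A) = mu A].

Definition rdiag (x : 'rV[R]_n) : 'M[scalar]_n := diag_mx (map_mx (@of_real R b) x).

(* The real part makes [Tr] a genuine trace (cyclic, conjugation invariant) in
   the quaternionic case; each quaternionic dimension counts once, so
   [Tr 1%:M] is [n] for the three values of [b]. *)
Definition Tr (A : 'M[scalar]_n) : R := realpart (\tr A).

(* [adjmx O] is the inverse of [O], for [O] in [Ggroup]. *)
Definition angM (mu : {measure set bmx -> \bar R}) (x y : 'rV[R]_n)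
    (i j : 'I_n) : R :=
  \int[mu]_(O in Ggroup)
    (modulus ((O : 'M[scalar]_n) i j) ^+ 2 *
     expR (Tr (rdiag x *m (O : 'M[scalar]_n) *m rdiag y *m adjmx O))).

End Groups.

Lemma Tr_XOYOinv (R : realType) (b : dyson) (n : nat) (x y : 'rV[R]_n)
    (O : 'M[scalar R b]_n) :
  Tr (rdiag b x *m O *m rdiag b y *m adjmx O) =
  \sum_(i < n) \sum_(j < n) x 0 i * y 0 j * modulus (O i j) ^+ 2.
Proof.
have reD (u v : scalar R b) : realpart (u + v) = realpart u + realpart v.
  by case: b u v {O} => [||] => // -[? ?] [].
have re0 : realpart (0 : scalar R b) = 0 by case: b {O reD}.
have re_sum (F : 'I_n -> scalar R b) :
    realpart (\sum_k F k) = \sum_k realpart (F k).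
  exact: (big_morph _ reD re0).
have reE (s t : R) (z : scalar R b) :
    realpart (of_real b s * z * of_real b t * conjs z) =
    s * t * modulus z ^+ 2.
  rewrite /modulus sqr_sqrtr; last by apply: sumr_ge0 => *; exact: sqr_ge0.
  case: b z {O reD re0 re_sum} => [z|[z1 z2]|[z1 z2 z3 z4]];
    rewrite /realpart /= !big_cons big_nil /=; ring.
rewrite /Tr /mxtrace re_sum; apply: eq_bigr => i _.
rewrite mxE re_sum; apply: eq_bigr => j _.
by rewrite mul_mx_diag mxE mul_diag_mx !mxE reE.
Qed.

(* Main.v *)
Require Import Defs.
From HB Require Import structures.
From mathcomp Require Import all_boot all_order all_algebra.
From mathcomp Require Import complex ring lra.
From mathcomp Require Import all_classical all_reals all_analysis.
From mathcomp Require Import measurable_realfun.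

(* The second equation is an integration by parts. Let O' be O with its rows i
   and k rotated by the unitary exp(t (u E_ik - conj(u) E_ki)), |u| = 1. The
   integral of Re(u O'_kj conj(O'_ij)) exp(Tr X O' Y O'^-1) does not depend on t;
   its derivative at 0 gives

     M_ij - M_kj = 2 (x_i - x_k) \int sum_q y_q Re(u O_kj conj(O_ij))
                       Re(u O_kq conj(O_iq)) exp(Tr X O Y O^-1).

   Summing over the 2 beta basic units u by Parseval, and then over k <> i by
   the orthogonality of the columns j and q of O, leaves y_j M_ij minus the
   derivative of M_ij in x_i. The first equation follows from the second since
   M_ij(X, Y) = M_ji(Y, X), by invariance of the Haar measure under O -> O^-1. *)

Import Order.TTheory GRing.Theory Num.Theory.
Import numFieldNormedType.Exports.

Set Implicit Arguments.
Unset Strict Implicit.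
Unset Printing Implicit Defensive.

Local Open Scope classical_set_scope.
Local Open Scope ring_scope.

(** * Real, complex and quaternionic scalars as Euclidean spaces *)

Section ScalarAlgebra.
Variables (R : realType) (b : dyson).
Local Notation S := (Defs.scalar R b).
Implicit Types z w u : S.

(** This is the Euclidean inner product of the real coordinates of [z] and [w]. *)
Definition inner z w : R := realpart (z * conjs w).

Lemma realpartD z w : realpart (z + w) = realpart z + realpart w.
Proof. by case: b z w => [//|[? ?] [? ?]|[????] [????]]. Qed.

Lemma realpart0 : realpart (0 : S) = 0.
Proof. by case: b. Qed.

Lemma realpartN z : realpart (- z) = - realpart z.
Proof. by apply/eqP; rewrite -addr_eq0 -realpartD addNr realpart0. Qed.

Lemma realpart_sum I (r : seq I) (P : pred I) (F : I -> S) :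
  realpart (\sum_(i <- r | P i) F i) = \sum_(i <- r | P i) realpart (F i).
Proof. exact: (big_morph _ realpartD realpart0). Qed.

Lemma conjsD z w : conjs (z + w) = conjs z + conjs w.
Proof.
case: b z w => [//|[a1 a2] [b1 b2]|[a1 a2 a3 a4] [b1 b2 b3 b4]].
- by apply/eqP; rewrite eq_complex /= opprD !eqxx.
- by congr Quat => /=; rewrite ?opprD.
Qed.

Lemma conjs0 : conjs (0 : S) = 0.
Proof.
case: b => [//||]; first by apply/eqP; rewrite eq_complex /= oppr0 !eqxx.
by congr Quat => /=; rewrite oppr0.
Qed.

Lemma conjs1 : conjs (1 : S) = 1.
Proof.
case: b => [//||]; first by apply/eqP; rewrite eq_complex /= oppr0 !eqxx.
by congr Quat => /=; rewrite oppr0.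
Qed.

Lemma conjsK : involutive (@conjs R b).
Proof.
move=> z; case: b z => [//|[a1 a2]|[a1 a2 a3 a4]].
- by apply/eqP; rewrite eq_complex /= opprK !eqxx.
- by congr Quat => /=; rewrite opprK.
Qed.

Lemma conjsN z : conjs (- z) = - conjs z.
Proof. by apply/eqP; rewrite -addr_eq0 -conjsD addNr conjs0. Qed.

Lemma conjsM z w : conjs (z * w) = conjs w * conjs z.
Proof.
case: b z w => [z w|[a1 a2] [b1 b2]|[a1 a2 a3 a4] [b1 b2 b3 b4]].
- exact: mulrC.
- by apply/eqP; rewrite eq_complex /=; apply/andP; split; apply/eqP; ring.
- by congr Quat => /=; ring.
Qed.

Lemma conjs_sum I (r : seq I) (P : pred I) (F : I -> S) :
  conjs (\sum_(i <- r | P i) F i) = \sum_(i <- r | P i) conjs (F i).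
Proof. exact: (big_morph _ conjsD conjs0). Qed.

Lemma conjs_of_real (a : R) : conjs (of_real b a) = of_real b a.
Proof.
case: b => [//||]; first by apply/eqP; rewrite eq_complex /= oppr0 !eqxx.
by congr Quat => /=; rewrite oppr0.
Qed.

Lemma of_realM (s t : R) : of_real b (s * t) = of_real b s * of_real b t.
Proof.
case: b => [//||].
- by apply/eqP; rewrite eq_complex /=; apply/andP; split; apply/eqP; ring.
- by congr Quat => /=; ring.
Qed.

Lemma of_realD (s t : R) : of_real b (s + t) = of_real b s + of_real b t.
Proof.
case: b => [//||].
- by apply/eqP; rewrite eq_complex /=; apply/andP; split; apply/eqP; ring.
- by congr Quat => /=; ring.
Qed.

Lemma of_real1 : of_real b (1 : R) = 1.
Proof. by case: b. Qed.

Lemma of_realC (s : R) z : of_real b s * z = z * of_real b s.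
Proof.
case: b z => [z|[a1 a2]|[a1 a2 a3 a4]].
- exact: mulrC.
- by apply/eqP; rewrite eq_complex /=; apply/andP; split; apply/eqP; ring.
- by congr Quat => /=; ring.
Qed.

Lemma modulus_sqr z : modulus z ^+ 2 = inner z z.
Proof.
rewrite /modulus sqr_sqrtr; last by apply: sumr_ge0 => *; exact: sqr_ge0.
rewrite /inner; case: b z => [z|[z1 z2]|[z1 z2 z3 z4]];
  rewrite /realpart /= !big_cons big_nil /=; ring.
Qed.

Lemma inner_ge0 z : 0 <= inner z z.
Proof. by rewrite -modulus_sqr sqr_ge0. Qed.

Lemma inner_eq0 z : inner z z = 0 -> z = 0.
Proof.
move/eqP; rewrite -modulus_sqr sqrf_eq0 sqrtr_eq0 => z0.
have : all (fun a => a == 0) (coords z).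
  have : \sum_(a <- coords z) a ^+ 2 == 0.
    by rewrite eq_le z0 sumr_ge0// => *; exact: sqr_ge0.
  rewrite psumr_eq0; last by move=> *; exact: sqr_ge0.
  by apply: sub_all => a /=; rewrite sqrf_eq0.
case: b z {z0} => [z|[z1 z2]|[z1 z2 z3 z4]] /=.
- by rewrite andbT => /eqP.
- by move=> /and3P[/eqP-> /eqP-> _].
- by move=> /and5P[/eqP-> /eqP-> /eqP-> /eqP-> _].
Qed.

Lemma modulus_conjs z : modulus (conjs z) = modulus z.
Proof.
by case: b z => [z|[z1 z2]|[z1 z2 z3 z4]];
  rewrite /modulus /= !big_cons big_nil /= ?sqrrN.
Qed.

(** The standard orthonormal basis of the scalars over the reals. Its length 2 beta is the source of
    the coefficient beta in the equations. *)
Definition units : seq S :=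
  match b return seq (Defs.scalar R b) with
  | BetaHalf => [:: 1]
  | BetaOne => [:: Complex 1 0; Complex 0 1]
  | BetaTwo => [:: Quat 1 0 0 0; Quat 0 1 0 0; Quat 0 0 1 0; Quat 0 0 0 1]
  end.

Lemma size_units : (size units)%:R = 2 * beta R b :> R.
Proof. by rewrite /units; case: b => /=; lra. Qed.

(* Parseval's identity in the orthonormal basis [units] *)
Lemma sum_units z w z' w' :
  \sum_(u <- units) inner (u * z) w * inner (u * z') w' =
  realpart (w * (conjs z * z') * conjs w').
Proof.
rewrite /units /inner.
case: b z w z' w' => [????|[??] [??] [??] [??]|[????] [????] [????] [????]];
  rewrite !big_cons big_nil /realpart /=; ring.
Qed.

Lemma units_mulVs u : u \in units -> u * conjs u = 1.
Proof.
rewrite /units; case: b u => [u|u|u]; rewrite !inE.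
- by move=> /eqP->; exact: mulr1.
- case/orP=> /eqP->; apply/eqP; rewrite eq_complex /=;
  by apply/andP; split; apply/eqP; ring.
- by case/or4P=> /eqP->; congr Quat => /=; ring.
Qed.

Lemma units_mulsV u : u \in units -> conjs u * u = 1.
Proof.
rewrite /units; case: b u => [u|u|u]; rewrite !inE.
- by move=> /eqP->; exact: mulr1.
- case/orP=> /eqP->; apply/eqP; rewrite eq_complex /=;
  by apply/andP; split; apply/eqP; ring.
- by case/or4P=> /eqP->; congr Quat => /=; ring.
Qed.

Lemma realpart_conjs z : realpart (conjs z) = realpart z.
Proof. by case: b z => [z|[z1 z2]|[z1 z2 z3 z4]]. Qed.

Lemma realpartC z w : realpart (z * w) = realpart (w * z).
Proof.
case: b z w => [z w|[z1 z2] [w1 w2]|[z1 z2 z3 z4] [w1 w2 w3 w4]];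
  rewrite /realpart /=; ring.
Qed.

Lemma realpart_of_realM (s : R) z : realpart (of_real b s * z) = s * realpart z.
Proof.
by case: b z => [z|[z1 z2]|[z1 z2 z3 z4]]; rewrite /realpart /= ?mul0r ?subr0.
Qed.

Lemma realpart_of_real (s : R) : realpart (of_real b s) = s.
Proof. by case: b. Qed.

Lemma mul_conjs z : z * conjs z = of_real b (inner z z).
Proof.
rewrite /inner /realpart; case: b z => [z|[z1 z2]|[z1 z2 z3 z4]] //=.
  by apply/eqP; rewrite eq_complex /=; apply/andP; split; apply/eqP; ring.
by congr Quat => /=; ring.
Qed.

Lemma innerC z w : inner z w = inner w z.
Proof. by rewrite /inner -realpart_conjs conjsM conjsK. Qed.

Lemma innerDl z z' w : inner (z + z') w = inner z w + inner z' w.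
Proof. by rewrite /inner mulrDl realpartD. Qed.

Lemma innerDr z w w' : inner z (w + w') = inner z w + inner z w'.
Proof. by rewrite ![inner z _]innerC innerDl. Qed.

Lemma innerNl z w : inner (- z) w = - inner z w.
Proof. by rewrite /inner mulNr realpartN. Qed.

Lemma innerNr z w : inner z (- w) = - inner z w.
Proof. by rewrite ![inner z _]innerC innerNl. Qed.

Lemma innerZl s z w : inner (of_real b s * z) w = s * inner z w.
Proof. by rewrite /inner -mulrA realpart_of_realM. Qed.

Lemma innerZr s z w : inner z (of_real b s * w) = s * inner z w.
Proof. by rewrite ![inner z _]innerC innerZl. Qed.

(** Left multiplication by [conjs u] is the adjoint of left multiplication by [u]. The real part is
    cyclic even for quaternions. *)
Lemma inner_conjsMl u z w : inner (conjs u * z) w = inner (u * w) z.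
Proof. by rewrite [RHS]innerC /inner conjsM mulrA [RHS]realpartC mulrA. Qed.

Lemma inner_unit u z w : u \in units -> inner (u * z) (u * w) = inner z w.
Proof.
by move=> uU; rewrite innerC -inner_conjsMl mulrA units_mulsV// mul1r.
Qed.

Lemma inner_unit_conjs u z w :
  u \in units -> inner (conjs u * z) (conjs u * w) = inner z w.
Proof.
by move=> uU; rewrite inner_conjsMl mulrA units_mulVs// mul1r innerC.
Qed.

Section Rotation.
Variables (u z w : S) (c s : R).
Hypothesis uU : u \in units.
(** [zi] and [zk] are the entries of rows i and k in one column after the rotation, when [z] and [w]
    are the entries before it; compare [rotmx_mulE]. *)
Let zi := of_real b c * z + of_real b s * (u * w).
Let zk := of_real b c * w - of_real b s * (conjs u * z).

Lemma inner_rot1 : inner zi zi =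
  c ^+ 2 * inner z z + s ^+ 2 * inner w w + 2 * (c * s) * inner (u * w) z.
Proof.
rewrite /zi !(innerDl, innerDr, innerZl, innerZr) inner_unit//.
rewrite (innerC z (u * w)); ring.
Qed.

Lemma inner_rot2 : inner zk zk =
  c ^+ 2 * inner w w + s ^+ 2 * inner z z - 2 * (c * s) * inner (u * w) z.
Proof.
rewrite /zk !(innerDl, innerDr, innerNl, innerNr, innerZl, innerZr).
rewrite inner_unit_conjs// (innerC w (conjs u * z)) inner_conjsMl; ring.
Qed.

Lemma inner_rot12 : inner (u * zk) zi =
  (c ^+ 2 - s ^+ 2) * inner (u * w) z + c * s * (inner w w - inner z z).
Proof.
have -> : u * zk = of_real b c * (u * w) - of_real b s * z.
  rewrite /zk mulrDr mulrN !mulrA -!of_realC; congr (_ - _).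
  by rewrite -!mulrA (mulrA u) units_mulVs// mul1r.
rewrite /zi !(innerDl, innerDr, innerNl, innerNr, innerZl, innerZr).
rewrite inner_unit// (innerC z (u * w)); ring.
Qed.

End Rotation.

(** The squared norms of [u * z + w] and [u * z - w] are nonnegative, which bounds twice the inner
    product by the sum of the squared norms of [z] and [w]. *)
Lemma inner_unit_le1 u z w : u \in units ->
  inner z z <= 1 -> inner w w <= 1 -> `|inner (u * z) w| <= 1.
Proof.
move=> uU z1 w1.
have h1 := inner_ge0 (u * z + w); have h2 := inner_ge0 (u * z - w).
move: h1 h2; rewrite !(innerDl, innerDr, innerNl, innerNr) inner_unit//.
rewrite (innerC w) => h1 h2; rewrite ler_norml; apply/andP; split; lra.
Qed.

End ScalarAlgebra.

(** * Measurability of scalar-valued functions, coordinate by coordinate *)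

Section ScalarMeasurability.
Variables (R : realType) (b : dyson).
Local Notation S := (Defs.scalar R b).
Context d (T : measurableType d).
Implicit Types f g : T -> S.

(** The index [k] may exceed the real dimension: the coordinate is then the default 0. *)
Definition smeas f :=
  forall k, measurable_fun setT (fun t => (coords (f t))`_k).

Lemma smeas_cst (a : S) : smeas (fun=> a).
Proof. by move=> k; exact: measurable_cst. Qed.

Lemma coordsD (z w : S) k :
  (coords (z + w))`_k = (coords z)`_k + (coords w)`_k.
Proof.
by case: b z w => [? ?|[??] [??]|[????] [????]];
  do 5?[case: k => [|k] //=]; rewrite addr0.
Qed.

Lemma smeasD f g : smeas f -> smeas g -> smeas (fun t => f t + g t).
Proof.
move=> mf mg k; under eq_fun do rewrite coordsD.
exact: measurable_funD.
Qed.

Lemma smeas_sum I (r : seq I) (F : I -> T -> S) :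
  (forall i, smeas (F i)) -> smeas (fun t => \sum_(i <- r) F i t).
Proof.
move=> mF; elim: r => [|i r IH].
  by under eq_fun do rewrite big_nil; exact: smeas_cst.
by under eq_fun do rewrite big_cons; exact: smeasD.
Qed.

Lemma smeas_conjs f : smeas f -> smeas (fun t => conjs (f t)).
Proof.
(* Conjugation keeps the real coordinate and flips the sign of all others. *)
move=> mf k; pose e : R := if k == 0%N then 1 else -1.
rewrite (_ : (fun t => _) = fun t => e * (coords (f t))`_k).
  by apply: measurable_funM => //; exact: measurable_cst.
apply/funext => t; rewrite {}/e; move: (f t) => {f mf} z.
by case: b z => [?|[??]|[????]]; do 5?[case: k => [|k] //=];
  rewrite ?mul1r ?mulN1r ?oppr0.
Qed.

(** Multiplication is real-bilinear, and the [c p q] are its structure constants. The range of four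
    indices covers all three algebras, as coordinates past the dimension are 0. *)
Lemma coordsM k : exists c : nat -> nat -> R, forall z w : S,
  (coords (z * w))`_k =
  \sum_(p < 4) \sum_(q < 4) c p q * ((coords z)`_p * (coords w)`_q).
Proof.
(* [e p] is the basis unit of index [p], and 0 once [p] reaches the dimension. *)
pose e p : S := match b return Defs.scalar R b with
  | BetaHalf => (p == 0%N)%:R
  | BetaOne => Complex (p == 0%N)%:R (p == 1%N)%:R
  | BetaTwo =>
    Quat (p == 0%N)%:R (p == 1%N)%:R (p == 2%N)%:R (p == 3%N)%:R
  end.
exists (fun p q => (coords (e p * e q))`_k) => z w.
rewrite !big_ord_recl !big_ord0 {}/e.
case: b z w => [z w|[z0 z1] [w0 w1]|[z0 z1 z2 z3] [w0 w1 w2 w3]];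
  by do 5?[case: k => [|k]] => //=; ring.
Qed.

Lemma smeasM f g : smeas f -> smeas g -> smeas (fun t => f t * g t).
Proof.
move=> mf mg k; have [c cE] := coordsM k; under eq_fun do rewrite cE.
apply: measurable_sum => p; apply: measurable_sum => q.
apply: measurable_funM; first exact: measurable_cst.
exact: measurable_funM.
Qed.

Lemma smeas_realpart f :
  smeas f -> measurable_fun setT (fun t => realpart (f t)).
Proof. by move/(_ 0%N). Qed.

Lemma smeas_inner f g :
  smeas f -> smeas g -> measurable_fun setT (fun t => inner (f t) (g t)).
Proof.
by move=> mf mg; apply: smeas_realpart; apply: smeasM => //; exact: smeas_conjs.
Qed.

Lemma smeas_eq0 f : smeas f -> measurable [set t | f t = 0].
Proof.
move=> mf.
rewrite (_ : [set t | _] = (fun t => inner (f t) (f t)) @^-1` [set 0]).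
  rewrite -[X in measurable X]setTI; apply: smeas_inner => //.
apply/seteqP; split=> t /=; first by move->; rewrite /inner mul0r realpart0.
exact: inner_eq0.
Qed.

End ScalarMeasurability.

(** * The group of unitary matrices and the bound on its entries *)

Section Group.
Variables (R : realType) (b : dyson) (n : nat).
Local Notation S := (Defs.scalar R b).
Local Notation M := 'M[S]_n.
Local Notation G := (@Ggroup R b n).
Implicit Types A B O P : M.

Lemma adjmxK : involutive (@adjmx R b n).
Proof. by move=> A; apply/matrixP => i j; rewrite !mxE conjsK. Qed.

Lemma adjmxM A B : adjmx (A *m B) = adjmx B *m adjmx A.
Proof.
apply/matrixP => i j; rewrite !mxE conjs_sum; apply: eq_bigr => k _.
by rewrite !mxE conjsM.
Qed.

Lemma Ggroup_adj O : G O -> G (adjmx O).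
Proof. by case=> h1 h2; split; rewrite adjmxK. Qed.

Lemma GgroupM O P : G O -> G P -> G (O *m P).
Proof.
case=> o1 o2 [p1 p2]; split; rewrite adjmxM mulmxA.
  by rewrite -(mulmxA O) p1 mulmx1.
by rewrite -(mulmxA (adjmx P)) o2 mulmx1.
Qed.

Lemma Ggroup_row O i : G O -> \sum_j inner (O i j) (O i j) = 1.
Proof.
case=> /matrixP/(_ i i) + _; rewrite !mxE eqxx => /(congr1 (@realpart R b)).
rewrite realpart_sum => h.
transitivity (realpart (1 : S)); last by rewrite /realpart; case: (b).
by rewrite -h; apply: eq_bigr => j _; rewrite !mxE.
Qed.

Lemma Ggroup_entry_le1 O i j : G O -> inner (O i j) (O i j) <= 1.
Proof.
move=> GO; rewrite -(Ggroup_row i GO) (bigD1 j)//= lerDl.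
by apply: sumr_ge0 => *; exact: inner_ge0.
Qed.

End Group.

(** * Measurability of the matrix operations and of the group *)

Section MatrixMeasurability.
Variables (R : realType) (b : dyson) (n : nat).
Local Notation S := (Defs.scalar R b).
Local Notation M := 'M[S]_n.
Local Notation G := (@Ggroup R b n).
Local Notation bmx := (bmx R b n).

Lemma smeas_entry i j : smeas (fun O : bmx => (O : M) i j).
Proof.
move=> k _ B mB; rewrite setTI; apply: sub_sigma_algebra.
by exists i, j, k, B.
Qed.

(** Measurability into a generated sigma-algebra need only be tested on the generating cylinders. *)
Lemma measurable_entries d (T : measurableType d) (f : T -> bmx) :
  (forall i j, smeas (fun t => (f t : M) i j)) -> measurable_fun setT f.
Proof.
move=> mf; apply: (@measurability _ _ T bmx setT f (@coord_cylinders R b n)) => //.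
by move=> _ [_ [i [j [k [B [mB ->]]]]] <-]; exact: mf.
Qed.

Lemma smeas_mulmx d (T : measurableType d) (f g : T -> M) i j :
  (forall i j, smeas (fun t => f t i j)) ->
  (forall i j, smeas (fun t => g t i j)) ->
  smeas (fun t => (f t *m g t) i j).
Proof.
move=> mf mg k; under eq_fun do rewrite mxE; move: k.
by apply: smeas_sum => k; exact: smeasM.
Qed.

Lemma smeas_adjmx d (T : measurableType d) (f : T -> M) i j :
  (forall i j, smeas (fun t => f t i j)) ->
  smeas (fun t => adjmx (f t) i j).
Proof.
move=> mf k; under eq_fun do rewrite !mxE; move: k.
exact: smeas_conjs.
Qed.

Lemma measurable_matrix_eq d (T : measurableType d) (f : T -> M) (A : M) :
  (forall i j, smeas (fun t => f t i j)) -> measurable [set t | f t = A].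
Proof.
move=> mf.
have -> : [set t | f t = A] =
    \bigcap_(p in [set: 'I_n * 'I_n]) [set t | f t p.1 p.2 - A p.1 p.2 = 0].
  apply/seteqP; split => t /=; first by move=> fA p _; rewrite /= fA subrr.
  by move=> h; apply/matrixP => i j; have /eqP := h (i, j) I;
    rewrite subr_eq0 => /eqP.
apply: fin_bigcap_measurable => // p _.
by apply: smeas_eq0; apply: smeasD => //; exact: smeas_cst.
Qed.

Lemma measurable_Ggroup : measurable (G : set bmx).
Proof.
have mi := @smeas_entry.
by apply: measurableI; apply: measurable_matrix_eq => i j;
  apply: smeas_mulmx => // k l; exact: smeas_adjmx.
Qed.

Lemma measurable_lmul (A : M) : measurable_fun setT (fun O : bmx => A *m O : bmx).
Proof.
apply: measurable_entries => i j; apply: smeas_mulmx => // k l.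
  exact: smeas_cst.
exact: smeas_entry.
Qed.

Lemma measurable_adjmx : measurable_fun setT (fun O : bmx => adjmx O : bmx).
Proof.
by apply: measurable_entries => i j; apply: smeas_adjmx => k l; exact: smeas_entry.
Qed.

Lemma smeas_comp d d' (T : measurableType d) (U : measurableType d')
  (h : T -> U) (f : U -> S) : measurable_fun setT h -> smeas f -> smeas (f \o h).
Proof. by move=> mh mf k; apply: measurableT_comp (mf k) mh. Qed.

Lemma measurable_adjmul :
  measurable_fun setT (fun p : bmx * bmx => adjmx p.1 *m p.2 : bmx).
Proof.
apply: measurable_entries => i j; apply: smeas_mulmx => k l.
  apply: smeas_adjmx => i' j'.
  exact: (smeas_comp measurable_fst (@smeas_entry i' j')).
exact: (smeas_comp measurable_snd (@smeas_entry k l)).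
Qed.

End MatrixMeasurability.

(** * Invariance of Haar integrals under left translation and inversion *)

Section Haar.
Variables (R : realType) (b : dyson) (n : nat).
Local Notation S := (Defs.scalar R b).
Local Notation M := 'M[S]_n.
Local Notation G := (@Ggroup R b n : set (Defs.bmx R b n)).
Local Notation bmx := (bmx R b n).
Variable mu : {measure set bmx -> \bar R}.
Hypothesis hmu : is_haar mu.

Let mG : measurable G := @measurable_Ggroup R b n.

Lemma preimage_lmul (A : M) : G A ->
  (fun O : bmx => A *m O : bmx) @^-1` G = G.
Proof.
move=> GA; apply/seteqP; split => O /=; last exact: GgroupM.
move=> h; have := GgroupM (Ggroup_adj GA) h.
by rewrite mulmxA GA.2 mul1mx.
Qed.

(** [is_haar] speaks of images under translations; the preimage under [A] is the image under its
    inverse [adjmx A]. *)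
Lemma haar_pushforward (A : M) (B : set bmx) : G A -> measurable B ->
  B `<=` G -> pushforward mu (fun O : bmx => A *m O : bmx) B = mu B.
Proof.
move=> GA mB BG; case: hmu => _ _ /(_ (adjmx A) B (Ggroup_adj GA) mB BG) <-.
rewrite /pushforward; congr (mu _); apply/seteqP; split => O /=.
  by move=> h; exists (A *m O) => //; rewrite mulmxA GA.2 mul1mx.
by case=> P BP <-; rewrite mulmxA GA.1 mul1mx.
Qed.

Section LeftTranslation.
Variable A : M.
Hypothesis GA : G A.
Let lmul (O : bmx) : bmx := A *m O.
Let lmul_mixin := isMeasurableFun.Build _ _ _ _ lmul (measurable_lmul A).
Let mlmul : {mfun bmx >-> bmx} := HB.pack lmul lmul_mixin.

(** This nonnegative version serves the Tonelli argument for inversion; [Rintegral_lmul] serves the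
    integration by parts. *)
Lemma ge0_integral_lmul (f : bmx -> \bar R) :
  measurable_fun G f -> (forall O, G O -> 0 <= f O)%E ->
  (\int[mu]_(O in G) f (A *m (O : M)) = \int[mu]_(O in G) f O)%E.
Proof.
move=> mf f0.
rewrite [RHS](eq_measure_integral (pushforward mu mlmul)); last first.
  by move=> B mB BG; apply/esym; exact: haar_pushforward.
rewrite (@ge0_integral_pushforward _ _ _ _ _ _ (measurable_lmul A))//.
  by rewrite preimage_lmul.
by move=> O; rewrite inE; exact: f0.
Qed.

Lemma Rintegral_lmul (f : bmx -> R) :
  measurable_fun setT f -> mu.-integrable G (fun O => (f (A *m (O : M)))%:E) ->
  \int[mu]_(O in G) f (A *m (O : M)) = \int[mu]_(O in G) f O.
Proof.
move=> mf intf; congr fine.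
rewrite [RHS](eq_measure_integral (pushforward mu mlmul)); last first.
  by move=> B mB BG; apply/esym; exact: haar_pushforward.
rewrite (@integral_pushforward _ _ _ _ _ _ (measurable_lmul A))//.
- by rewrite preimage_lmul.
- exact/measurable_EFinP.
- by rewrite preimage_lmul.
Qed.

End LeftTranslation.

Lemma bounded_integrable (f : bmx -> R) (C : R) :
  measurable_fun setT f -> (forall O, G O -> `|f O| <= C) ->
  mu.-integrable G (EFin \o f).
Proof.
move=> mf fC; apply: measurable_bounded_integrable => //.
- by case: hmu.
- exact: measurable_funTS.
- exists C; split; first exact: num_real.
  by move=> x Cx O GO; apply: le_trans (ltW Cx); exact: fC.
Qed.

(* Tonelli on G x G for g(P^-1 O): a left-invariant finite measure on a group is
   invariant under inversion. *)
Lemma ge0_integral_adjmx (g : bmx -> \bar R) :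
  measurable_fun setT g -> (forall O, 0 <= g O)%E ->
  (\int[mu]_(O in G) g (adjmx (O : M)) = \int[mu]_(O in G) g O)%E.
Proof.
move=> mg g0; have [G0 Goo _] := hmu.
(* Only the mass of [mu] on [G] is known to be finite, so Tonelli is applied to the restriction of
   [mu] to [G]. *)
pose nu : {finite_measure set bmx -> \bar R} := mfrestr mG Goo.
have nuE (f : bmx -> \bar R) :
    (\int[nu]_O (f \_ G) O = \int[mu]_(O in G) f O)%E.
  rewrite -integral_mkcond; apply: eq_measure_integral => B mB BG.
  by rewrite /nu /= /mfrestr /mrestr setIidl.
pose h (p : bmx * bmx) := g (adjmx p.1 *m p.2 : bmx).
have mh : measurable_fun setT (h \_ (G `*` G)).
  apply/(measurable_restrictT _ _).1; first exact: measurableX.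
  apply: measurable_funTS.
  exact: measurableT_comp mg (@measurable_adjmul R b n).
have h0 p : (0 <= (h \_ (G `*` G)) p)%E.
  by apply: erestrict_ge0 => q _; exact: g0.
have hE P O : (h \_ (G `*` G)) (P, O) =
    if (P \in G) && (O \in G) then g (adjmx P *m (O : M)) else 0%E.
  by rewrite patchE in_setX.
set I := RHS; set J := LHS.
(* For fixed P, left invariance in O removes the factor P^-1. *)
have LI : (\int[nu]_P \int[nu]_O (h \_ (G `*` G)) (P, O) =
    \int[mu]_(P in G) I)%E.
  rewrite -nuE; apply: eq_integral => P _; rewrite patchE.
  case: (boolP (P \in G)) => PG; last first.
    apply: integral0_eq => O _; by rewrite hE (negbTE PG).
  rewrite -[RHS](@ge0_integral_lmul _ (Ggroup_adj (set_mem PG)) g)//.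
    rewrite -nuE; apply: eq_integral => O _.
    by rewrite hE PG patchE.
  exact: measurable_funTS.
(* For fixed O, P^-1 O is the inverse of O^-1 P, and left invariance in P removes O^-1. *)
have RJ : (\int[nu]_O \int[nu]_P (h \_ (G `*` G)) (P, O) =
    \int[mu]_(P in G) J)%E.
  rewrite -nuE; apply: eq_integral => O _; rewrite patchE.
  case: (boolP (O \in G)) => OG; last first.
    apply: integral0_eq => P _; by rewrite hE (negbTE OG) andbF.
  rewrite -[RHS](@ge0_integral_lmul _ (Ggroup_adj (set_mem OG))
    (fun Q : bmx => g (adjmx Q)))//.
    rewrite -nuE; apply: eq_integral => P _.
    by rewrite hE OG andbT patchE adjmxM adjmxK.
  apply: measurable_funTS.
  exact: measurableT_comp mg (@measurable_adjmx R b n).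
have : (I * mu G = J * mu G)%E.
  rewrite -!integral_cst//.
  by rewrite -LI -RJ; exact: fubini_tonelli.
(* The mass of [G] is finite and nonzero, hence can be cancelled. *)
have -> : mu G = (fine (mu G))%:E by rewrite fineK// ge0_fin_numE.
have r0 : fine (mu G) != 0 by rewrite gt_eqF// fine_gt0// G0.
move=> /(congr1 (fun z => z * (fine (mu G))^-1%:E)%E).
by rewrite -!muleA -EFinM divff// !mule1 => ->.
Qed.

End Haar.

(** * Bounded integrands: linearity and differentiation under the integral *)

Section BoundedMeasurable.
Variables (R : realType) (b : dyson) (n : nat).
Local Notation S := (Defs.scalar R b).
Local Notation M := 'M[S]_n.
Local Notation G := (@Ggroup R b n : set (Defs.bmx R b n)).
Local Notation bmx := (bmx R b n).
Implicit Types f g : bmx -> R.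

(** The bound is asked on [G] only, since matrix entries are unbounded elsewhere. As [G] has finite
    mass, such functions are integrable over it. *)
Definition bmeas f :=
  measurable_fun setT f /\ exists C, forall O, G O -> `|f O| <= C.

Lemma bmeas_cst (a : R) : bmeas (fun=> a).
Proof. by split; [exact: measurable_cst|exists `|a|]. Qed.

Lemma bmeasD f g : bmeas f -> bmeas g -> bmeas (fun O => f O + g O).
Proof.
move=> [mf [C fC]] [mg [D gD]]; split; first exact: measurable_funD.
exists (C + D) => O GO; apply: le_trans (ler_normD _ _) _.
by apply: lerD; [exact: fC|exact: gD].
Qed.

Lemma bmeasM f g : bmeas f -> bmeas g -> bmeas (fun O => f O * g O).
Proof.
move=> [mf [C fC]] [mg [D gD]]; split; first exact: measurable_funM.
exists (C * D) => O GO; rewrite normrM.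
by apply: ler_pM => //; [exact: fC|exact: gD].
Qed.

Lemma bmeasB f g : bmeas f -> bmeas g -> bmeas (fun O => f O - g O).
Proof.
move=> mf mg; have := bmeasD mf (bmeasM (bmeas_cst (-1)) mg).
by under eq_fun do rewrite mulN1r.
Qed.

Lemma bmeas_sum (I : eqType) (r : seq I) (P : pred I) (F : I -> bmx -> R) :
  {in r, forall i, bmeas (F i)} -> bmeas (fun O => \sum_(i <- r | P i) F i O).
Proof.
elim: r => [|i r IH] mF.
  by under eq_fun do rewrite big_nil; exact: bmeas_cst.
under eq_fun do rewrite big_cons.
have {}IH := IH (fun p pr => mF p (mem_behead (s := i :: r) pr)).
by case: (P i) => //; apply: bmeasD => //; exact: mF (mem_head _ _).
Qed.

Lemma bmeas_expR f : bmeas f -> bmeas (fun O => expR (f O)).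
Proof.
move=> [mf [C fC]]; split; first exact: measurableT_comp (@measurable_expR R) mf.
exists (expR C) => O GO; rewrite ger0_norm ?expR_ge0// ler_expR.
exact: le_trans (ler_norm _) (fC _ GO).
Qed.

Lemma bmeas_inner u p p' q : u \in units R b ->
  bmeas (fun O => inner (u * (O : M) p q) ((O : M) p' q)).
Proof.
move=> uU; split; last first.
  by exists 1 => O GO; apply: inner_unit_le1 => //; exact: Ggroup_entry_le1.
apply: smeas_inner; last exact: smeas_entry.
by apply: smeasM; [exact: smeas_cst|exact: smeas_entry].
Qed.

Lemma bmeas_sq p q : bmeas (fun O => inner ((O : M) p q) ((O : M) p q)).
Proof.
split; first by apply: smeas_inner; exact: smeas_entry.
exists 1 => O GO; rewrite ger0_norm ?inner_ge0//; exact: Ggroup_entry_le1.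
Qed.

Variable mu : {measure set bmx -> \bar R}.
Hypothesis hmu : is_haar mu.

Lemma bmeas_integrable f : bmeas f -> mu.-integrable G (EFin \o f).
Proof. by move=> [mf [C fC]]; exact: bounded_integrable fC. Qed.

Let mG : measurable G := @measurable_Ggroup R b n.

Lemma Rint_D f g : bmeas f -> bmeas g ->
  \int[mu]_(O in G) (f O + g O) = \int[mu]_(O in G) f O + \int[mu]_(O in G) g O.
Proof. by move=> mf mg; rewrite RintegralD//; exact: bmeas_integrable. Qed.

Lemma Rint_B f g : bmeas f -> bmeas g ->
  \int[mu]_(O in G) (f O - g O) = \int[mu]_(O in G) f O - \int[mu]_(O in G) g O.
Proof. by move=> mf mg; rewrite RintegralB//; exact: bmeas_integrable. Qed.

Lemma Rint_Z a f : bmeas f ->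
  \int[mu]_(O in G) (a * f O) = a * \int[mu]_(O in G) f O.
Proof. by move=> mf; rewrite RintegralZl//; exact: bmeas_integrable. Qed.

Lemma Rint_sum (I : eqType) (r : seq I) (P : pred I) (F : I -> bmx -> R) :
  {in r, forall i, bmeas (F i)} ->
  \int[mu]_(O in G) (\sum_(i <- r | P i) F i O) =
  \sum_(i <- r | P i) \int[mu]_(O in G) F i O.
Proof.
elim: r => [|i r IH] mF.
  under eq_Rintegral do rewrite big_nil.
  by rewrite Rintegral_cst// mul0r big_nil.
under eq_Rintegral do rewrite big_cons; rewrite big_cons.
have mr p : p \in r -> bmeas (F p).
  by move=> pr; apply: mF; exact: (mem_behead (s := i :: r) pr).
have mi := mF _ (mem_head i r).
by case: (P i); rewrite ?Rint_D ?IH//; exact: bmeas_sum.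
Qed.

(** On a space of finite mass a constant is an integrable dominating function, so uniform bounds
    within distance 1 of [a] suffice. *)
Lemma Rint_is_derive (f f' : R -> bmx -> R) (a : R) :
  (forall t, measurable_fun setT (f t)) ->
  (exists C, forall t O, G O -> `|t - a| < 1 -> `|f t O| <= C) ->
  (exists C, forall t O, G O -> `|t - a| < 1 -> `|f' t O| <= C) ->
  (forall (t : R) O, G O -> is_derive t (1 : R) (f^~ O) (f' t O)) ->
  is_derive a (1 : R) (fun t => \int[mu]_(O in G) f t O) (\int[mu]_(O in G) f' a O).
Proof.
move=> mf [C fC] [D fD] df.
have near_a t : `]a - 1, a + 1[%classic t -> `|t - a| < 1.
  by rewrite /= in_itv /= -ltr_distlC distrC.
have Ia : `]a - 1, a + 1[%classic a by rewrite /= in_itv /=; lra.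
have h1 t : `]a - 1, a + 1[%classic t -> mu.-integrable G (EFin \o f t).
  move=> It; apply: (@bounded_integrable _ _ _ _ hmu _ C) => // O GO.
  exact: fC (near_a _ It).
have h2 t O : `]a - 1, a + 1[%classic t -> G O -> derivable (f^~ O) t 1.
  by move=> _ GO; case: (df t O GO).
(* The dominating function has to be nonnegative; taking [|D|] avoids exhibiting a point of [G] to
   see that [D] is. *)
have D0 : 0 <= `|D| by [].
have h3 : mu.-integrable G (EFin \o (fun=> `|D|)).
  exact: bmeas_integrable (bmeas_cst _).
have dE t O : G O -> partial1of2 f t O = f' t O.
  by move=> GO; rewrite partial1of2E; case: (df t O GO).
have h4 t O : `]a - 1, a + 1[%classic t -> G O -> `|partial1of2 f t O| <= `|D|.
  move=> It GO; rewrite dE//; apply: le_trans (ler_norm D).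
  exact: fD (near_a _ It).
split.
  exact: (derivable_under_integral mG Ia h1 h2 _ h3 h4).
rewrite -derive1E (differentiation_under_integral mG Ia h1 h2 _ h3 h4)//.
by apply: eq_Rintegral => O; rewrite inE => GO; exact: dE.
Qed.

End BoundedMeasurable.

(** * Derivatives of one real variable, and of the rotated quadratic forms *)

Section Derivatives.
Variable R : realType.
Implicit Types (f g : R -> R) (t : R).

Lemma is_derive_add f g t df dg : is_derive t (1 : R) f df ->
  is_derive t (1 : R) g dg ->
  is_derive t (1 : R) (fun t => f t + g t) (df + dg).
Proof. by move=> hf hg; exact: (is_deriveD hf hg). Qed.

Lemma is_derive_mul f g t df dg : is_derive t (1 : R) f df ->
  is_derive t (1 : R) g dg ->
  is_derive t (1 : R) (fun t => f t * g t) (f t * dg + g t * df).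
Proof. by move=> hf hg; exact: (is_deriveM hf hg). Qed.

Lemma is_derive_scale f t df a : is_derive t (1 : R) f df ->
  is_derive t (1 : R) (fun t => a * f t) (a * df).
Proof. by move=> hf; exact: (is_deriveZ a hf). Qed.

Lemma is_derive_sum_ord n (F : 'I_n -> R -> R) t (dF : 'I_n -> R) :
  (forall i, is_derive t (1 : R) (F i) (dF i)) ->
  is_derive t (1 : R) (fun t => \sum_i F i t) (\sum_i dF i).
Proof.
move=> hF; have := is_derive_sum hF.
by congr is_derive; apply/funext => s; rewrite fct_sumE.
Qed.

Lemma is_derive_expR_comp f t df : is_derive t (1 : R) f df ->
  is_derive t (1 : R) (fun t => expR (f t)) (expR (f t) * df).
Proof. by move=> hf; exact: (is_derive1_comp (is_derive_expR (f t)) hf). Qed.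

(* [A], [B] are the squared norms of two vectors and [C] is their inner product. *)
Lemma is_derive_rot (A B C t : R) :
  is_derive t (1 : R)
    (fun t => cos t ^+ 2 * A + sin t ^+ 2 * B + 2 * (cos t * sin t) * C)
    (2 * ((cos t ^+ 2 - sin t ^+ 2) * C + cos t * sin t * (B - A))).
Proof.
have hc := is_derive_cos t; have hs := is_derive_sin t.
have e : (fun t => cos t ^+ 2 * A + sin t ^+ 2 * B + 2 * (cos t * sin t) * C) =
    (fun t => (A * (cos t * cos t) + B * (sin t * sin t)) +
              (2 * C) * (cos t * sin t)).
  by apply/funext => s; ring.
rewrite e; refine (is_derive_eq (is_derive_add (is_derive_add
  (is_derive_scale A (is_derive_mul hc hc))
  (is_derive_scale B (is_derive_mul hs hs)))
  (is_derive_scale (2 * C) (is_derive_mul hc hs))) _).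
ring.
Qed.

(** Companion of [is_derive_rot]: the derivative of [inner_rot1] is twice [inner_rot12], whose
    derivative is [inner_rot2] minus [inner_rot1]. The squares of [cos] and [sin] stay unreduced so
    that both results read as forms in the rotated vectors. *)
Lemma is_derive_rot_inner (A B C t : R) :
  is_derive t (1 : R)
    (fun t => (cos t ^+ 2 - sin t ^+ 2) * C + cos t * sin t * (B - A))
    ((cos t ^+ 2 * B + sin t ^+ 2 * A - 2 * (cos t * sin t) * C) -
     (cos t ^+ 2 * A + sin t ^+ 2 * B + 2 * (cos t * sin t) * C)).
Proof.
have hc := is_derive_cos t; have hs := is_derive_sin t.
have e : (fun t => (cos t ^+ 2 - sin t ^+ 2) * C + cos t * sin t * (B - A)) =
    (fun t => (C * (cos t * cos t) + (- C) * (sin t * sin t)) +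
              (B - A) * (cos t * sin t)).
  by apply/funext => s; ring.
rewrite e; refine (is_derive_eq (is_derive_add (is_derive_add
  (is_derive_scale C (is_derive_mul hc hc))
  (is_derive_scale (- C) (is_derive_mul hs hs)))
  (is_derive_scale (B - A) (is_derive_mul hc hs))) _).
ring.
Qed.

End Derivatives.

(** * Rotations of two rows by a unit scalar *)

Section Rotation.
Variables (R : realType) (b : dyson) (n : nat).
Local Notation S := (Defs.scalar R b).
Local Notation M := 'M[S]_n.
Local Notation G := (@Ggroup R b n).
Variables (i k : 'I_n) (u : S).
Hypothesis ki : k != i.
Hypothesis uU : u \in units R b.

(* exp(t (u E_ik - conj(u) E_ki)) for [c = cos t] and [s = sin t] *)
Definition rotmx (c s : R) : M := \matrix_(p, q)
  if p == i then
    if q == i then of_real b c else if q == k then of_real b s * u else 0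
  else if p == k then
    if q == i then - (of_real b s * conjs u)
    else if q == k then of_real b c else 0
  else if p == q then 1 else 0.

Lemma rotmx_mulE c s (O : M) p q : (rotmx c s *m O) p q =
  if p == i then of_real b c * O i q + of_real b s * (u * O k q)
  else if p == k then of_real b c * O k q - of_real b s * (conjs u * O i q)
  else O p q.
Proof.
rewrite mxE; case: (eqVneq p i) => [->|pi]; last case: (eqVneq p k) => [->|pk].
- rewrite (bigD1 i)//= (bigD1 k)//= big1 => [|m /andP[mi mk]].
    by rewrite !mxE !eqxx (negbTE ki) addr0 mulrA.
  by rewrite mxE eqxx (negbTE mi) (negbTE mk) mul0r.
- rewrite (bigD1 i)//= (bigD1 k)//= big1 => [|m /andP[mi mk]].
    by rewrite !mxE !eqxx (negbTE ki) addr0 mulNr mulrA addrC.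
  by rewrite mxE eqxx (negbTE ki) (negbTE mi) (negbTE mk) mul0r.
- rewrite (bigD1 p)//= big1 => [|m mp].
    by rewrite mxE (negbTE pi) (negbTE pk) eqxx mul1r addr0.
  by rewrite mxE (negbTE pi) (negbTE pk) eq_sym (negbTE mp) mul0r.
Qed.

Lemma of_realN (s : R) : of_real b (- s) = - of_real b s.
Proof. by apply/eqP; rewrite -addr_eq0 -of_realD addNr; case: (b). Qed.

(** The generator is skew-adjoint, so taking adjoints reverses the angle. *)
Lemma adj_rotmx c s : adjmx (rotmx c s) = rotmx c (- s).
Proof.
apply/matrixP => p q; rewrite !mxE.
have [pi | pi] := eqVneq p i; have [qi | qi] := eqVneq q i;
  rewrite ?pi ?qi ?eqxx ?(negbTE pi) ?(negbTE qi) ?[i == k]eq_sym ?(negbTE ki) /=.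
- exact: conjs_of_real.
- case: ifP => _; last exact: conjs0.
  by rewrite conjsN conjsM conjsK conjs_of_real of_realN mulNr of_realC.
- case: ifP => _; last exact: conjs0.
  by rewrite conjsM conjs_of_real of_realN mulNr opprK of_realC.
case: (eqVneq p k) => [pk|pk]; case: (eqVneq q k) => [qk|qk];
  rewrite ?pk ?qk ?eqxx ?(negbTE pk) ?(negbTE qk) ?[k == q]eq_sym ?(negbTE qk)
    ?conjs0 ?conjs_of_real//.
by rewrite eq_sym; case: ifP; rewrite ?conjs0 ?conjs1.
Qed.

Lemma rotmxV c s : c ^+ 2 + s ^+ 2 = 1 -> rotmx c s *m rotmx c (- s) = 1%:M.
Proof.
move=> cs.
have cs' : of_real b c * of_real b c + of_real b s * of_real b s = 1.
  by rewrite -!of_realM -of_realD -!expr2 cs of_real1.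
apply/matrixP => p q; rewrite rotmx_mulE.
have [pi|pi] := eqVneq p i; last have [pk|pk] := eqVneq p k.
- rewrite !mxE !eqxx (negbTE ki) pi [i == q]eq_sym of_realN.
  case: ifP => [_|_].
    rewrite mulNr opprK !mulrA -(mulrA _ u) -(of_realC s u) !mulrA -mulrA.
    by rewrite units_mulVs// mulr1.
  case: ifP => [_|_]; last by rewrite !mulr0 addr0.
  by rewrite -(of_realC c u) !mulNr !mulrN !mulrA -!of_realM mulrC addNr.
- rewrite !mxE !eqxx (negbTE ki) pk [k == q]eq_sym of_realN.
  case: (eqVneq q i) => [->|_].
    rewrite [i == k]eq_sym (negbTE ki) -(of_realC c (conjs u)).
    by rewrite mulNr opprK !mulrA -!of_realM [s * c]mulrC subrr.
  case: ifP => [_|_]; last by rewrite !mulr0 subrr.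
  rewrite !mulNr !mulrN opprK !mulrA -(mulrA _ (conjs u)) -(of_realC s (conjs u)).
  by rewrite !mulrA -(mulrA _ (conjs u)) units_mulsV// mulr1.
- by rewrite !mxE (negbTE pi) (negbTE pk); case: ifP.
Qed.

Lemma Ggroup_rotmx t : G (rotmx (cos t) (sin t)).
Proof.
split; rewrite adj_rotmx; first by rewrite rotmxV// cos2Dsin2.
by rewrite -{2}[sin t]opprK rotmxV// sqrrN cos2Dsin2.
Qed.

Lemma rotmx0 (O : M) : rotmx 1 0 *m O = O.
Proof.
have o0 : of_real b (0 : R) = 0 by case: (b).
apply/matrixP => p q; rewrite rotmx_mulE of_real1 o0 !mul0r subr0 addr0 !mul1r.
by case: eqP => [->//|_]; case: eqP => [->|].
Qed.

End Rotation.

(** * The moments as integrals of squared moduli: symmetry and derivative *)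

Section MomentIdentities.
Variables (R : realType) (b : dyson) (n : nat).
Local Notation S := (Defs.scalar R b).
Local Notation M := 'M[S]_n.
Local Notation G := (@Ggroup R b n : set (Defs.bmx R b n)).
Local Notation bmx := (bmx R b n).
Variable mu : {measure set bmx -> \bar R}.
Hypothesis hmu : is_haar mu.
Implicit Types (x y : 'rV[R]_n) (O : M).

Definition sqn O p q : R := inner (O p q) (O p q).

(** By [Tr_XOYOinv] this is the exponent Tr X O Y O^-1. *)
Definition energy x y O : R := \sum_p \sum_q x 0 p * y 0 q * sqn O p q.

Lemma angME x y i j :
  angM mu x y i j = \int[mu]_(O in G) (sqn O i j * expR (energy x y O)).
Proof.
apply: eq_Rintegral => O _; rewrite modulus_sqr; congr (_ * expR _).
rewrite Tr_XOYOinv; apply: eq_bigr => p _; apply: eq_bigr => q _.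
by rewrite modulus_sqr.
Qed.

Lemma bmeas_sqn p q : bmeas (fun O : bmx => sqn O p q).
Proof. exact: bmeas_sq. Qed.

Lemma bmeas_energy x y : bmeas (fun O : bmx => energy x y O).
Proof.
apply: bmeas_sum => p _; apply: bmeas_sum => q _.
by apply: bmeasM; [exact: bmeas_cst|exact: bmeas_sqn].
Qed.

Lemma bmeas_exp_energy x y : bmeas (fun O : bmx => expR (energy x y O)).
Proof. exact: bmeas_expR (bmeas_energy x y). Qed.

(** Passing from O to O^-1 transposes the array of squared moduli, conjugation being isometric; in
    the exponent this exchanges [x] and [y]. *)
Lemma angM_sym x y i j : angM mu x y i j = angM mu y x j i.
Proof.
rewrite !angME; congr fine.
pose g (O : bmx) : \bar R := (sqn O j i * expR (energy y x O))%:E.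
rewrite -[RHS](ge0_integral_adjmx hmu (g := g)).
- apply: eq_integral => O _; rewrite /g; congr (_ * expR _)%:E.
    by rewrite /sqn mxE [map_mx _ _ _ _]mxE -!modulus_sqr modulus_conjs.
  rewrite /energy exchange_big; apply: eq_bigr => p _; apply: eq_bigr => q _.
  by rewrite /sqn mxE [map_mx _ _ _ _]mxE -!modulus_sqr modulus_conjs
    [x 0 _ * _]mulrC.
- apply/measurable_EFinP.
  exact: (bmeasM (bmeas_sqn j i) (bmeas_exp_energy y x)).1.
- by move=> O; rewrite lee_fin mulr_ge0 ?expR_ge0 ?inner_ge0.
Qed.

Lemma angM_is_derive x y i j :
  derivable (fun x' => angM mu x' y i j) x (delta_mx 0 i) /\
  'D_(delta_mx 0 i) (fun x' => angM mu x' y i j) x =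
  \int[mu]_(O in G) (sqn O i j * (\sum_q y 0 q * sqn O i q) *
                    expR (energy x y O)).
Proof.
(* The exponent is affine in x_i, with slope [T]. *)
pose T (O : bmx) : R := \sum_q y 0 q * sqn O i q.
pose f t (O : bmx) : R := sqn O i j * expR (energy x y O + t * T O).
pose f' t (O : bmx) : R := sqn O i j * T O * expR (energy x y O + t * T O).
have fE t : angM mu (t *: delta_mx 0 i + x) y i j = \int[mu]_(O in G) f t O.
  rewrite angME; apply: eq_Rintegral => O _; congr (_ * expR _).
  rewrite /energy (bigD1 i)//= [in RHS](bigD1 i)//= addrAC; congr (_ + _).
    rewrite /T mulr_sumr -big_split/=; apply: eq_bigr => q _.
    by rewrite !mxE !eqxx /=; ring.
  apply: eq_bigr => p pi; apply: eq_bigr => q _.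
  by rewrite !mxE (negbTE pi) mulr0 add0r.
have bT : bmeas T.
  by apply: bmeas_sum => q _; apply: bmeasM; [exact: bmeas_cst|exact: bmeas_sqn].
have [CT CTE] := bT.2.
have [CE CEE] := (bmeas_energy x y).2.
have bexp t O : G O -> `|t - 0| < 1 ->
    `|expR (energy x y O + t * T O)| <= expR (CE + CT).
  move=> GO; rewrite subr0 => t1; rewrite ger0_norm ?expR_ge0// ler_expR.
  apply: le_trans (ler_norm _) _; apply: le_trans (ler_normD _ _) _.
  apply: lerD; first exact: CEE.
  rewrite normrM; apply: le_trans (CTE _ GO).
  by rewrite ler_piMl// ltW.
have [C1 C1E] := (bmeas_sqn i j).2.
have [C2 C2E] := (bmeasM (bmeas_sqn i j) bT).2.
have dF : is_derive (0 : R) (1 : R) (fun t => \int[mu]_(O in G) f t O)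
                                    (\int[mu]_(O in G) f' 0 O).
  apply: Rint_is_derive => //.
  - move=> t.
    exact: (bmeasM (bmeas_sqn i j) (bmeas_expR (bmeasD (bmeas_energy x y)
      (bmeasM (bmeas_cst b n t) bT)))).1.
  - exists (C1 * expR (CE + CT)) => t O GO t1; rewrite normrM.
    by apply: ler_pM => //; [exact: C1E|exact: bexp].
  - exists (C2 * expR (CE + CT)) => t O GO t1; rewrite normrM.
    by apply: ler_pM => //; [exact: C2E|exact: bexp].
  - move=> t O GO.
    refine (is_derive_eq (is_derive_scale _ (is_derive_expR_comp
      (is_derive_add (is_derive_cst (energy x y O) t (1 : R))
        (is_derive_mul (is_derive_id t (1 : R))
          (is_derive_cst (T O) t (1 : R)))))) _).
    rewrite /f' /cst /=; ring.
(* The difference quotient in the direction of x_i is that of a function of one real variable at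
   0. *)
have hE : (fun h : R => h^-1 *: (((fun x' => angM mu x' y i j) \o shift x)
      (h *: delta_mx 0 i) - angM mu x y i j)) =
    (fun h : R => h^-1 *: (((fun t => \int[mu]_(O in G) f t O) \o shift 0)
      (h *: (1 : R)) - \int[mu]_(O in G) f 0 O)).
  apply/funext => h; rewrite /= -!fE scale0r add0r addr0.
  by rewrite /GRing.scale /= mulr1.
case: dF => d1 d2; split.
  by rewrite /derivable hE.
rewrite /derive hE; move: d2; rewrite /derive => ->.
by apply: eq_Rintegral => O _; rewrite /f' mul0r addr0.
Qed.

End MomentIdentities.

(** * Integration by parts along a rotation of rows i and k *)

Section SchwingerDyson.
Variables (R : realType) (b : dyson) (n : nat).
Local Notation S := (Defs.scalar R b).
Local Notation M := 'M[S]_n.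
Local Notation G := (@Ggroup R b n : set (Defs.bmx R b n)).
Local Notation bmx := (bmx R b n).
Variable mu : {measure set bmx -> \bar R}.
Hypothesis hmu : is_haar mu.
Variables (x y : 'rV[R]_n).

Section OneRotation.
Variables (i k : 'I_n) (u : S).
Hypothesis ki : k != i.
Hypothesis uU : u \in units R b.

(** Half the rate of change of [sqn O i q] under the rotation. *)
Definition row_inner q (O : M) : R := inner (u * O k q) (O i q).

Let rotm t : M := rotmx i k u (cos t) (sin t).

Lemma bmeas_row_inner q : bmeas (fun O : bmx => row_inner q O).
Proof. exact: bmeas_inner. Qed.

Lemma is_derive_row_inner (O : M) q t :
  is_derive t (1 : R) (fun t => row_inner q (rotm t *m O))
    (sqn (rotm t *m O) k q - sqn (rotm t *m O) i q).
Proof.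
have E s : row_inner q (rotm s *m O) =
    (cos s ^+ 2 - sin s ^+ 2) * row_inner q O +
    cos s * sin s * (sqn O k q - sqn O i q).
  by rewrite {1}/row_inner !rotmx_mulE// !eqxx (negbTE ki) inner_rot12.
rewrite (_ : (fun _ => _) = fun s => (cos s ^+ 2 - sin s ^+ 2) * row_inner q O +
    cos s * sin s * (sqn O k q - sqn O i q)); last by apply/funext => s; exact: E.
refine (is_derive_eq (is_derive_rot_inner _ _ _ _) _).
rewrite /sqn !rotmx_mulE// !eqxx (negbTE ki) inner_rot1// inner_rot2//.
Qed.

(** In each column, row i gains what row k loses and the other rows are fixed; the difference of
    indicators merges the three cases. *)
Lemma is_derive_sqn (O : M) p q t :
  is_derive t (1 : R) (fun t => sqn (rotm t *m O) p q)
    (2 * ((p == i)%:R - (p == k)%:R) * row_inner q (rotm t *m O)).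
Proof.
rewrite /row_inner /sqn.
under eq_fun do rewrite !rotmx_mulE//.
rewrite !rotmx_mulE// !eqxx (negbTE ki) inner_rot12//.
have [pi|pi] := eqVneq p i; last have [pk|pk] := eqVneq p k.
- rewrite pi [i == k]eq_sym (negbTE ki).
  under eq_fun do rewrite inner_rot1//.
  refine (is_derive_eq (is_derive_rot _ _ _ _) _); rewrite /=; ring.
- under eq_fun do rewrite inner_rot2// -mulrN.
  refine (is_derive_eq (is_derive_rot _ _ _ _) _); rewrite /=; ring.
- refine (is_derive_eq (is_derive_cst _ _ _) _); rewrite /=; ring.
Qed.

Lemma is_derive_energy (O : M) t :
  is_derive t (1 : R) (fun t => energy x y (rotm t *m O))
    (2 * (x 0 i - x 0 k) * \sum_q y 0 q * row_inner q (rotm t *m O)).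
Proof.
refine (is_derive_eq (is_derive_sum_ord (fun p => is_derive_sum_ord (fun q =>
  is_derive_scale (x 0 p * y 0 q) (is_derive_sqn O p q t)))) _).
rewrite [LHS](bigD1 i)//= [X in _ + X = _](bigD1 k)//=.
rewrite [X in _ + (_ + X)]big1; last first.
  move=> p /andP[pi pk]; apply: big1 => q _.
  by rewrite (negbTE pi) (negbTE pk) subrr !(mulr0, mul0r).
rewrite addr0 mulr_sumr -big_split; apply: eq_bigr => q _ /=.
rewrite !eqxx (negbTE ki) [i == k]eq_sym (negbTE ki) /=; ring.
Qed.

(** By left invariance the integral of [h] at the rotated matrix is constant in the angle; the left
    side is its derivative at angle 0. *)
Lemma schwinger_dyson j :
  \int[mu]_(O in G) ((sqn O k j - sqn O i j + 2 * (x 0 i - x 0 k) *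
     \sum_q y 0 q * (row_inner j O * row_inner q O)) * expR (energy x y O)) = 0.
Proof.
pose h (O : bmx) : R := row_inner j O * expR (energy x y O).
(* At every angle, [h'] at the rotated matrix is the derivative of [h] along the rotation, so one
   bound on [G] dominates all of them. *)
pose h' (O : bmx) : R := (sqn O k j - sqn O i j + 2 * (x 0 i - x 0 k) *
     \sum_q y 0 q * (row_inner j O * row_inner q O)) * expR (energy x y O).
have bh : bmeas h by apply: bmeasM; [exact: bmeas_row_inner|exact: bmeas_exp_energy].
have bh' : bmeas h'.
  apply: bmeasM; last exact: bmeas_exp_energy.
  apply: bmeasD; first by apply: bmeasB; exact: bmeas_sqn.
  apply: bmeasM; first exact: bmeas_cst.
  apply: bmeas_sum => q _; apply: bmeasM; first exact: bmeas_cst.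
  by apply: bmeasM; exact: bmeas_row_inner.
have Grot t : G (rotm t) by exact: Ggroup_rotmx.
have mrot t : measurable_fun setT (fun O : bmx => h (rotm t *m (O : M))).
  exact: measurableT_comp bh.1 (measurable_lmul (rotm t)).
have [C hC] := bh.2; have [D hD] := bh'.2.
have dF : is_derive (0 : R) (1 : R)
    (fun t => \int[mu]_(O in G) h (rotm t *m (O : M)))
    (\int[mu]_(O in G) h' (rotm 0 *m (O : M))).
  apply: (Rint_is_derive hmu (f := fun t O => h (rotm t *m (O : M)))
    (f' := fun t O => h' (rotm t *m (O : M)))) => //.
  - by exists C => t O GO _; apply: hC; exact: GgroupM.
  - by exists D => t O GO _; apply: hD; exact: GgroupM.
  - move=> t O GO.
    refine (is_derive_eq (is_derive_mul (is_derive_row_inner O j t)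
      (is_derive_expR_comp (is_derive_energy O t))) _).
    rewrite /h' [X in _ = (_ + _ * X) * _](_ : _ = row_inner j (rotm t *m O) *
      \sum_q y 0 q * row_inner q (rotm t *m O)); first by ring.
    by rewrite mulr_sumr; apply: eq_bigr => q _; rewrite mulrCA.
have Fcst : (fun t => \int[mu]_(O in G) h (rotm t *m (O : M))) =
    cst (\int[mu]_(O in G) h O).
  apply/funext => t; apply: (Rintegral_lmul hmu (Grot t) bh.1).
  apply: (@bounded_integrable _ _ _ _ hmu _ C); first exact: mrot.
  by move=> O GO; apply: hC; exact: GgroupM.
have r0 (O : bmx) : rotm 0 *m (O : M) = O by rewrite /rotm cos0 sin0 rotmx0.
case: dF => _; rewrite Fcst derive_cst => F0; rewrite [RHS]F0.
by apply: eq_Rintegral => O _; rewrite /h' r0.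
Qed.

End OneRotation.

(** * Summation over the units and over the rows k *)

Section RowEquation.
Variables i j : 'I_n.
Hypothesis xinj : injective (fun p : 'I_n => x 0 p).

(** The value of the sum over the units given by Parseval. The middle factor is grouped so that
    summing it over k yields an entry of [adjmx O *m O]. *)
Definition overlap (O : M) k q : R :=
  realpart (O i j * (conjs (O k j) * O k q) * conjs (O i q)).

Lemma sum_overlap_units (O : M) k q :
  \sum_(u <- units R b) row_inner i k u j O * row_inner i k u q O = overlap O k q.
Proof. exact: sum_units. Qed.

Lemma bmeas_overlap k q : bmeas (fun O : bmx => overlap O k q).
Proof.
under eq_fun do rewrite -sum_overlap_units.
by apply: bmeas_sum => u uU; apply: bmeasM; exact: bmeas_row_inner.
Qed.

(** Over all k, orthogonality of the columns j and q leaves only the case q = j; the subtracted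
    product is the term k = i. *)
Lemma sum_overlap (O : M) q : G O ->
  \sum_(k | k != i) overlap O k q = (q == j)%:R * sqn O i j - sqn O i j * sqn O i q.
Proof.
move=> [_ OO].
have full : \sum_k overlap O k q = (q == j)%:R * sqn O i j.
  rewrite -realpart_sum -mulr_suml -mulr_sumr.
  have -> : \sum_k conjs (O k j) * O k q = (j == q)%:R.
    move/matrixP/(_ j q): OO; rewrite !mxE => <-.
    by apply: eq_bigr => k _; rewrite !mxE.
  have [->|_] := eqVneq q j; first by rewrite mulr1 mul1r.
  by rewrite mulr0 !mul0r realpart0.
move: full; rewrite (bigD1 i)//= => <-.
have -> : overlap O i q = sqn O i j * sqn O i q.
  rewrite /overlap !mulrA mul_conjs -mulrA mul_conjs.
  by rewrite realpart_of_realM realpart_of_real.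
by rewrite addrAC subrr add0r.
Qed.

(** Sum [schwinger_dyson] over the 2 beta units: the difference of moments does not depend on the
    unit and acquires the factor 2 beta, whose 2 cancels the one in front of x_i - x_k. *)
Lemma angM_diff k : k != i ->
  beta R b * ((angM mu x y i j - angM mu x y k j) / (x 0 i - x 0 k)) =
  \int[mu]_(O in G) (\sum_q y 0 q * overlap O k q * expR (energy x y O)).
Proof.
move=> ki.
have xik : x 0 i - x 0 k != 0.
  by rewrite subr_eq0; apply: contraNneq ki => /xinj ->.
pose e (O : bmx) := expR (energy x y O).
pose A u (O : bmx) :=
  (\sum_q y 0 q * (row_inner i k u j O * row_inner i k u q O)) * e O.
have be : bmeas e by exact: bmeas_exp_energy.
have bA u : u \in units R b -> bmeas (A u).
  move=> uU; apply: bmeasM => //; apply: bmeas_sum => q _.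
  by apply: bmeasM; [exact: bmeas_cst|apply: bmeasM; exact: bmeas_row_inner].
set d := x 0 i - x 0 k in xik *.
have SD u : u \in units R b ->
    angM mu x y k j - angM mu x y i j + 2 * d * \int[mu]_(O in G) A u O = 0.
  move=> uU; rewrite -[RHS](schwinger_dyson ki uU j) !angME.
  have bs p : bmeas (fun O : bmx => sqn O p j * e O).
    by apply: bmeasM => //; exact: bmeas_sqn.
  rewrite -(Rint_B hmu (bs k) (bs i)) -(Rint_Z hmu _ (bA _ uU)) -Rint_D//.
  - by apply: eq_Rintegral => O _; rewrite /A /e -/d; ring.
  - exact: bmeasB.
  - by apply: bmeasM; [exact: bmeas_cst|exact: bA].
have : \sum_(u <- units R b) (angM mu x y k j - angM mu x y i j +
    2 * d * \int[mu]_(O in G) A u O) = 0.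
  by rewrite big_seq big1.
rewrite big_split/= -mulr_sumr -(Rint_sum hmu _ bA).
rewrite big_const_seq count_predT iter_addr_0 -[_ *+ size _]mulr_natl size_units => h.
have -> : \int[mu]_(O in G) (\sum_q y 0 q * overlap O k q * expR (energy x y O))
    = \int[mu]_(O in G) \sum_(u <- units R b) A u O.
  apply: eq_Rintegral => O _; rewrite -mulr_suml -mulr_suml exchange_big.
  congr (_ * _); apply: eq_bigr => q _.
  by rewrite -sum_overlap_units mulr_sumr.
apply: (mulIf xik); rewrite mulrA divfK//.
by move: h; set I := Rintegral _ _ _; lra.
Qed.

(** The derivative in x_i brings down the sum of y_q |O_iq|^2, and the k = i terms missing from the
    sum over k remove exactly this, leaving y_j. *)
Lemma row_equation :
  'D_(delta_mx 0 i) (fun x' => angM mu x' y i j) x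
  + beta R b * (\sum_(k < n | k != i)
       (angM mu x y i j - angM mu x y k j) / (x 0 i - x 0 k))
  = y 0 j * angM mu x y i j.
Proof.
rewrite (angM_is_derive hmu x y i j).2 mulr_sumr.
rewrite (eq_bigr _ (fun k ki => angM_diff ki)).
have bF k : bmeas (fun O : bmx =>
    \sum_q y 0 q * overlap O k q * expR (energy x y O)).
  apply: bmeas_sum => q _; apply: bmeasM; last exact: bmeas_exp_energy.
  by apply: bmeasM; [exact: bmeas_cst|exact: bmeas_overlap].
rewrite -(Rint_sum hmu _ (fun k _ => bF k)) -Rint_D//; last 2 first.
- apply: bmeasM; last exact: bmeas_exp_energy.
  apply: bmeasM; first exact: bmeas_sqn.
  apply: bmeas_sum => q _.
  by apply: bmeasM; [exact: bmeas_cst|exact: bmeas_sqn].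
- by apply: bmeas_sum => k _; exact: bF.
rewrite angME -Rint_Z//; last first.
  by apply: bmeasM; [exact: bmeas_sqn|exact: bmeas_exp_energy].
(* Under a single integral, the identity already holds pointwise on [G]. *)
apply: eq_Rintegral => O; rewrite inE => GO.
rewrite exchange_big/=.
have -> : \sum_q \sum_(k | k != i) y 0 q * overlap O k q * expR (energy x y O) =
    (y 0 j * sqn O i j - sqn O i j * (\sum_q y 0 q * sqn O i q)) *
    expR (energy x y O).
  have -> : y 0 j * sqn O i j = \sum_q y 0 q * ((q == j)%:R * sqn O i j).
    rewrite (bigD1 j)//= eqxx mul1r big1 ?addr0// => q /negbTE->.
    by rewrite mul0r mulr0.
  rewrite mulr_sumr -sumrB mulr_suml; apply: eq_bigr => q _.
  rewrite -mulr_suml -mulr_sumr sum_overlap//; ring.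
ring.
Qed.

End RowEquation.
End SchwingerDyson.

Theorem mainTheorem5 (R : realType) (b : dyson) (n : nat)
    (mu : {measure set (bmx R b n) -> \bar R}) (x y : 'rV[R]_n) :
  (1 <= n)%N -> is_haar mu ->
  injective (fun k : 'I_n => x 0 k) -> injective (fun k : 'I_n => y 0 k) ->
  let M := angM mu in
  forall i j : 'I_n,
    (derivable (fun y' : 'rV[R]_n => M x y' i j) y (delta_mx 0 j) /\
     'D_(delta_mx 0 j) (fun y' : 'rV[R]_n => M x y' i j) y
       + beta R b * (\sum_(l < n | l != j)
           (M x y i l - M x y i j) / (y 0 l - y 0 j))
     = x 0 i * M x y i j) /\
    (derivable (fun x' : 'rV[R]_n => M x' y i j) x (delta_mx 0 i) /\
     'D_(delta_mx 0 i) (fun x' : 'rV[R]_n => M x' y i j) x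
       + beta R b * (\sum_(k < n | k != i)
           (M x y i j - M x y k j) / (x 0 i - x 0 k))
     = y 0 j * M x y i j).
Proof.
move=> _ hmu xinj yinj M i j; split; last first.
  by split; [exact: (angM_is_derive hmu x y i j).1|exact: row_equation].
(* The equation in y_j is the one in x_i with [x], [y] and [i], [j] exchanged. *)
have -> : (fun y' => M x y' i j) = (fun y' => angM mu y' x j i).
  by apply/funext => y'; exact: angM_sym.
split; first exact: (angM_is_derive hmu y x j i).1.
rewrite /M [in RHS](angM_sym hmu) -row_equation//; congr (_ + _ * _).
apply: eq_bigr => l _; rewrite !(angM_sym hmu x y).
(* Numerator and denominator both appear with the opposite sign. *)
by rewrite -opprB -[y 0 l - _]opprB invrN mulrNN.
Qed.
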